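(* Let $R\subset\mathbb{R}^d$ be a polytope with normal fan $\mathcal{C}$, and let $V$ be a virtual polytope in $\mathbb{R}^d$ whose corresponding CPWL function $f_V$ is compatible with $\mathcal{C}$. Then every minimal representative $(P,Q)\in\mathcal{R}_{\mathcal{C}}(V)$ is a vertex of the polyhedron $\mathcal{R}_{\mathcal{C}}(V)$ (polytopes being considered modulo translation).
   Context: Let $\mathcal{P}_d$ be the set of (nonempty) polytopes in $\mathbb{R}^d$ with Minkowski addition $P+Q=\{p+q\mid p\in P,q\in Q\}$. A virtual polytope is an equivalence class $P-Q$ of pairs $(P,Q)\in\mathcal{P}_d\times\mathcal{P}_d$ under $(P_1,Q_1)\sim(P_2,Q_2)\iff P_1+Q_2=P_2+Q_1$. Virtual polytopes form a real vector space, with $\lambda(P-Q)=\lambda P-\lambda Q$ for $\lambda\ge0$ and $-(P-Q)=Q-P$. The support function of a polytope $P$ is $f_P(x)=\max_{y\in P}\langle y,x\rangle$; for a virtual polytope $V=P-Q$ the corresponding function is $f_V=f_P-f_Q$, a positively homogeneous continuous piecewise linear function (well-defined). It is compatible with a complete polyhedral fan $\mathcal{C}$ if it is linear on each cone of $\mathcal{C}$. The normal fan of $R$ is the complete fan of the normal cones $\{x\mid\langle z,x\rangle=\max_{y\in R}\langle y,x\rangle\ \forall z\in F\}$ over all nonempty faces $F$ of $R$. The deformation cone $\mathcal{DC}(R)$ is the set of polytopes $Q$ for which there exist a polytope $T$ and $\lambda>0$ with $\lambda R=Q+T$ (equivalently, the normal fan of $Q$ is a coarsening of that of $R$); modulo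 translation it is a pointed polyhedral cone in a finite-dimensional subspace of the space of virtual polytopes modulo translations. The representative polyhedron is $\mathcal{R}_{\mathcal{C}}(V)=\{(P,Q)\mid P,Q\in\mathcal{DC}(R),\ V=P-Q\}$, where polytopes and virtual polytopes are taken modulo translation: its elements are pairs of translation classes of polytopes in $\mathcal{DC}(R)$ and the equation $V=P-Q$ is understood up to translation. It is a polyhedron in the product of two copies of the vector space spanned by $\mathcal{DC}(R)$ modulo translation. A representative $(P,Q)\in\mathcal{R}_{\mathcal{C}}(V)$ is minimal if there is no other $(P',Q')\in\mathcal{R}_{\mathcal{C}}(V)$ such that $P'$ has at most as many vertices as $P$, $Q'$ has at most as many vertices as $Q$, and one of the two has strictly fewer vertices. *)

(* Defs.v *)
From HB Require Import structures.
From mathcomp Require Import all_boot all_order all_algebra generic_quotient.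
From mathcomp Require Import boolp classical_sets functions cardinality reals.
From mathcomp Require Import ring.

Set Implicit Arguments.
Unset Strict Implicit.
Unset Printing Implicit Defensive.

Import Order.TTheory GRing.Theory Num.Theory.
Local Open Scope ring_scope.
Local Open Scope classical_set_scope.
Local Open Scope card_scope.
Local Open Scope quotient_scope.

Section Face.
Variables (R : realType) (E : lmodType R).

(* l = 0 gives S itself; a functional unbounded on S gives the empty face. *)
Definition face (S F : set E) : Prop :=
  exists l : {scalar E}, F = [set x | S x /\ forall y, S y -> l y <= l x].

Definition vertex (S : set E) (v : E) : Prop := face S [set v].

Definition vertices (S : set E) : set E := [set v | vertex S v].

End Face.

Section ConvexHull.
Variables (R : realType) (d : nat).
Notation E := 'rV[R]_d.

Definition conv (I : finType) (v : I -> E) : set E :=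
  [set x | exists w : I -> R,
     [/\ forall i, 0 <= w i, \sum_i w i = 1 & x = \sum_i w i *: v i]].

Definition is_polytope (P : set E) : Prop :=
  exists n (v : 'I_n.+1 -> E), P = conv v.

Lemma conv_is_polytope (I : finType) (i0 : I) (v : I -> E) :
  is_polytope (conv v).
Proof.
have [n cI] : exists n, #|I| = n.+1.
  by exists #|I|.-1; rewrite prednK //; apply/card_gt0P; exists i0.
pose g (k : 'I_n.+1) : I := enum_val (cast_ord (esym cI) k).
pose h (i : I) : 'I_n.+1 := cast_ord cI (enum_rank i).
have gK : cancel g h.
  by move=> k; rewrite /g /h enum_valK cast_ordKV.
have hK : cancel h g.
  by move=> k; rewrite /g /h cast_ordK enum_rankK.
have bg : bijective g by exists h.
exists n, (v \o g); apply/seteqP; split => x [w [w0 w1 ->]].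
  exists (w \o g); split => [i||]; first exact: w0.
    by rewrite -w1 [RHS](reindex g) //; apply: onW_bij.
  by rewrite [LHS](reindex g) //; apply: onW_bij.
exists (w \o h); split => [i||]; first exact: w0.
  rewrite -w1 [LHS](reindex g); last exact: onW_bij.
  by apply: eq_bigr => i _ /=; rewrite gK.
rewrite [RHS](reindex g); last exact: onW_bij.
by apply: eq_bigr => i _ /=; rewrite gK.
Qed.

Lemma conv_convex (I : finType) (v : I -> E) (a b : R) (x y : E) :
  0 <= a -> 0 <= b -> a + b = 1 -> conv v x -> conv v y ->
  conv v (a *: x + b *: y).
Proof.
move=> a0 b0 ab [w [w0 w1 ->]] [u [u0 u1 ->]].
exists (fun i => a * w i + b * u i); split.
- by move=> i; rewrite addr_ge0 // mulr_ge0.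
- by rewrite big_split -!mulr_sumr /= w1 u1 !mulr1.
- rewrite !scaler_sumr -big_split /=; apply: eq_bigr => i _.
  by rewrite scalerDl !scalerA.
Qed.

Lemma conv_gen (I : finType) (v : I -> E) i : conv v (v i).
Proof.
exists (fun j => (j == i)%:R); split => [j||]; first exact: ler0n.
  by rewrite (bigD1 i) //= eqxx big1 ?addr0 // => j /negPf ->.
rewrite (bigD1 i) //= eqxx scale1r big1 ?addr0 // => j /negPf ->.
by rewrite scale0r.
Qed.

Lemma minkowski_is_polytope (P Q : set E) : is_polytope P -> is_polytope Q ->
  is_polytope [set p + q | p in P & q in Q].
Proof.
move=> [n [v ->]] [m [u ->]].
suff -> : [set p + q | p in conv v & q in conv u] =
    conv (fun ij : 'I_n.+1 * 'I_m.+1 => v ij.1 + u ij.2).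
  exact: (conv_is_polytope (ord0, ord0)).
apply/seteqP; split => x.
  move=> [_ [w [w0 w1 ->]]] [_ [z [z0 z1 ->]]] <-.
  exists (fun ij => w ij.1 * z ij.2); split.
  - by move=> ij; rewrite mulr_ge0.
  - rewrite -(pair_bigA _ (fun i j => w i * z j)) /=.
    under eq_bigr => i _ do rewrite -mulr_sumr z1 mulr1.
    exact: w1.
  - rewrite -(pair_bigA _ (fun i j => (w i * z j) *: (v i + u j))) /=.
    under [RHS]eq_bigr => i _.
      under eq_bigr => j _ do rewrite scalerDr.
      rewrite big_split /= -scaler_suml -mulr_sumr z1 mulr1.
      under [X in _ + X]eq_bigr => j _ do rewrite -scalerA.
      rewrite -scaler_sumr; over.
    by rewrite big_split /= -scaler_suml w1 scale1r.
move=> [w [w0 w1 ->]].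
exists (\sum_i (\sum_j w (i, j)) *: v i).
  exists (fun i => \sum_j w (i, j)); split => //.
    by move=> i; apply: sumr_ge0.
  by rewrite pair_bigA -w1; apply: eq_bigr => -[].
exists (\sum_j (\sum_i w (i, j)) *: u j).
  exists (fun j => \sum_i w (i, j)); split => //.
    by move=> j; apply: sumr_ge0.
  by rewrite exchange_big pair_bigA -w1; apply: eq_bigr => -[].
transitivity (\sum_i \sum_j w (i, j) *: (v i + u j)).
  under [RHS]eq_bigr => i _.
    under eq_bigr => j _ do rewrite scalerDr.
    rewrite big_split /= -scaler_suml; over.
  rewrite big_split /=; congr (_ + _).
  by rewrite exchange_big /=; apply: eq_bigr => j _; rewrite scaler_suml.
by rewrite pair_bigA; apply: eq_bigr => -[].
Qed.

Lemma scale_is_polytope (a : R) (P : set E) : is_polytope P ->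
  is_polytope [set a *: p | p in P].
Proof.
move=> [n [v ->]]; exists n, (fun i => a *: v i).
apply/seteqP; split => x.
  move=> [_ [w [w0 w1 ->]] <-]; exists w; split => //.
  by rewrite scaler_sumr; apply: eq_bigr => i _; rewrite !scalerA mulrC.
move=> [w [w0 w1 ->]]; exists (\sum_i w i *: v i); first by exists w.
by rewrite scaler_sumr; apply: eq_bigr => i _; rewrite !scalerA mulrC.
Qed.

Lemma set1_is_polytope (t : E) : is_polytope [set t].
Proof.
exists 0%N, (fun=> t); apply/seteqP; split => x.
  by move=> ->; exact: (conv_gen _ ord0).
by move=> [w [_ w1 ->]]; rewrite -scaler_suml w1 scale1r.
Qed.

(* Elimination of the last generator in a + C `<=` B + C, up to a rescaling;
   this gives the cancellation law below without any closedness argument. *)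
Lemma cancel_elim (I : finType) (v : I -> E) (a : E) n
    (c : 'I_n.+1 -> E) (s : 'I_n.+1 -> R) (b : 'I_n.+1 -> E)
    (M : 'I_n.+1 -> 'I_n.+1 -> R) :
  (forall i, 0 < s i) -> (forall i, conv v (b i)) ->
  (forall i j, 0 <= M i j) -> (forall i, \sum_j M i j = 1) ->
  (forall i, s i *: a + c i = s i *: b i + \sum_j M i j *: c j) ->
  conv v a.
Proof.
elim: n c s b M => [|n IH] c s b M s0 Hb M0 M1 H.
  have := H ord0; have := M1 ord0; rewrite !big_ord1 => ->.
  rewrite scale1r => /addIr /(congr1 (fun x => (s ord0)^-1 *: x)).
  by rewrite !scalerA mulVf ?gt_eqF // !scale1r => ->.
pose L := @ord_max n.+1; pose W := @widen_ord n.+1 n.+2 (leqnSn _).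
have HL := H L; have ML := M1 L; rewrite big_ord_recr /= in ML.
rewrite big_ord_recr /= in HL.
set m := M L ord_max in HL ML.
have m_le1 : m <= 1.
  by rewrite -ML lerDr; apply: sumr_ge0 => i _; exact: M0.
case: (eqVneq m 1) => [m1|mn1].
  have z j : M L (W j) = 0.
    have /eqP : \sum_(i < n.+1) M L (W i) = 0.
      by apply: (addIr m); rewrite add0r ML m1.
    rewrite psumr_eq0; last by move=> i _; exact: M0.
    by move=> /allP /(_ j); rewrite mem_index_enum /= => /(_ isT) /eqP.
  rewrite big1 ?add0r in HL; last by move=> j _; rewrite [M _ _]z scale0r.
  move: HL; rewrite m1 scale1r => /addIr /(congr1 (fun x => (s L)^-1 *: x)).
  by rewrite !scalerA mulVf ?gt_eqF // !scale1r => ->; exact: Hb.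
have k0 : 0 < 1 - m by rewrite subr_gt0 lt_neqAle mn1.
have kn0 : 1 - m != 0 by rewrite gt_eqF.
pose k := (1 - m)^-1.
have kp : 0 < k by rewrite invr_gt0.
have cL : c L = (k * s L) *: (b L - a) + \sum_(j < n.+1) (k * M L (W j)) *: c (W j).
  have : (1 - m) *: c L = s L *: (b L - a) + \sum_(j < n.+1) M L (W j) *: c (W j).
    rewrite scalerBl scale1r scalerBr.
    apply: (addrI (s L *: a)); rewrite addrA HL.
    rewrite -[ord_max]/L -/W.
    by rewrite [RHS]addrA [in RHS](addrC (s L *: a)) subrK -addrA -addrA subrr addr0.
  move=> /(congr1 (fun x => k *: x)).
  rewrite scalerA mulVf // scale1r => ->.
  rewrite scalerDr scalerA scaler_sumr; congr (_ + _).
  by apply: eq_bigr => j _; rewrite scalerA.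
pose r i := M (W i) L * (k * s L).
have r0 i : 0 <= r i by rewrite !mulr_ge0 // ltW.
pose s' i := s (W i) + r i.
have s'0 i : 0 < s' i by rewrite ltr_pwDl.
pose b' i := (s (W i) / s' i) *: b (W i) + (r i / s' i) *: b L.
apply: (IH (c \o W) s' b'
  (fun i j => M (W i) (W j) + M (W i) L * (k * M L (W j)))) => //.
- move=> i; apply: conv_convex => //.
  + by rewrite divr_ge0 // ltW.
  + by rewrite divr_ge0 // ltW.
  + by rewrite -mulrDl -/(s' i) divff // gt_eqF.
- by move=> i j; rewrite addr_ge0 // !mulr_ge0 // ltW.
- move=> i; rewrite big_split /= -!mulr_sumr.
  have -> : \sum_(j < n.+1) M L (W j) = 1 - m by rewrite -ML addrK.
  by rewrite mulVf // mulr1; have := M1 (W i); rewrite big_ord_recr.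
- move=> i /=; have := H (W i); rewrite big_ord_recr /= -[ord_max]/L => Hi.
  rewrite /b' scalerDr !scalerA.
  rewrite ![s' i * _]mulrCA divff ?gt_eqF // !mulr1.
  have cLi : M (W i) L *: c L = r i *: b L - r i *: a +
      \sum_(j < n.+1) (M (W i) L * (k * M L (W j))) *: c (W j).
    rewrite cL scalerDr scalerA -/(r i) scalerBr scaler_sumr; congr (_ + _).
    by apply: eq_bigr => j _; rewrite scalerA.
  rewrite scalerDl addrAC Hi cLi.
  under [in RHS]eq_bigr => j _ do rewrite scalerDl.
  rewrite big_split /= -/W.
  rewrite -[LHS]addrA -[RHS]addrA; congr (_ + _).
  rewrite addrAC -addrA -addrA [RHS]addrCA; congr (_ + _).
  by rewrite addrCA; congr (_ + _); rewrite addrA subrr add0r.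
Qed.

Lemma minkowski_cancel (A B C : set E) :
  is_polytope B -> is_polytope C ->
  [set p + q | p in A & q in C] `<=` [set p + q | p in B & q in C] ->
  A `<=` B.
Proof.
move=> [k [v ->]] [n [c ->]] sub a Aa.
have H i : exists bM : E * ('I_n.+1 -> R), [/\ conv v bM.1,
    forall j, 0 <= bM.2 j, \sum_j bM.2 j = 1 &
    a + c i = bM.1 + \sum_j bM.2 j *: c j].
  have [b Hb [_ [w [w0 w1 ->]] e]] :
      [set p + q | p in conv v & q in conv c] (a + c i).
    by apply: sub; exists a => //; exists (c i) => //; exact: conv_gen.
  by exists (b, w); split.
have [f Hf] := choice H.
apply: (@cancel_elim _ v a n c (fun=> 1) (fun i => (f i).1) (fun i => (f i).2)).
- by [].
- by move=> i; have [] := Hf i.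
- by move=> i; have [] := Hf i.
- by move=> i; have [] := Hf i.
- by move=> i; have [_ _ _] := Hf i; rewrite !scale1r.
Qed.

End ConvexHull.

Record polytope (R : realType) (d : nat) := Polytope {
  pset :> set 'rV[R]_d;
  psetP : is_polytope pset }.

HB.instance Definition _ R d := gen_eqMixin (polytope R d).
HB.instance Definition _ R d := gen_choiceMixin (polytope R d).

Section Polytopes.
Variables (R : realType) (d : nat).
Notation E := 'rV[R]_d.
Notation polytope := (polytope R d).
Implicit Types (P Q T : polytope) (a b : R).

Lemma polytope_eq P Q : pset P = pset Q -> P = Q.
Proof.
case: P Q => [P hP] [Q hQ] /= e; subst Q.
by congr Polytope; exact: Prop_irrelevance.
Qed.

Definition padd P Q : polytope :=
  Polytope (minkowski_is_polytope (psetP P) (psetP Q)).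

Definition pscale a P : polytope := Polytope (scale_is_polytope a (psetP P)).

Definition point (t : E) : polytope := Polytope (set1_is_polytope t).

Lemma paddA : associative padd.
Proof.
move=> P Q T; apply: polytope_eq; apply/seteqP; split => x /=.
  move=> [p Pp [_ [q Qq [t Tt <-]] <-]].
  by exists (p + q); [exists p => //; exists q|exists t; rewrite ?addrA].
move=> [_ [p Pp [q Qq <-]] [t Tt <-]].
by exists p => //; exists (q + t); [exists q => //; exists t|rewrite addrA].
Qed.

Lemma paddC : commutative padd.
Proof.
move=> P Q; apply: polytope_eq; apply/seteqP; split => x /=;
by move=> [p Pp [q Qq <-]]; exists q => //; exists p => //; rewrite addrC.
Qed.

Lemma padd0 : left_id (point 0) padd.
Proof.
move=> P; apply: polytope_eq; apply/seteqP; split => x /=.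
  by move=> [_ -> [p Pp <-]]; rewrite add0r.
by move=> Px; exists 0 => //; exists x => //; rewrite add0r.
Qed.

HB.instance Definition _ := GRing.isNmodule.Build polytope paddA paddC padd0.

Lemma paddE P Q : pset (P + Q) = [set p + q | p in P & q in Q].
Proof. by []. Qed.

Lemma paddI P Q T : P + T = Q + T -> P = Q.
Proof.
move=> e; apply: polytope_eq; apply/seteqP; split.
  apply: (minkowski_cancel (psetP Q) (psetP T)).
  by rewrite -!paddE e.
apply: (minkowski_cancel (psetP P) (psetP T)).
by rewrite -!paddE e.
Qed.

Lemma pscale1 P : pscale 1 P = P.
Proof.
apply: polytope_eq; apply/seteqP; split => x /=.
  by move=> [p Pp <-]; rewrite scale1r.
by move=> Px; exists x => //; rewrite scale1r.
Qed.

Lemma pscaleA a b P : pscale a (pscale b P) = pscale (a * b) P.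
Proof.
apply: polytope_eq; apply/seteqP; split => x /=.
  by move=> [_ [p Pp <-] <-]; exists p => //; rewrite scalerA.
by move=> [p Pp <-]; exists (b *: p); [exists p|rewrite scalerA].
Qed.

Lemma polytope_neq0 P : pset P !=set0.
Proof. by case: (psetP P) => n [v ->]; exists (v ord0); exact: conv_gen. Qed.

Lemma pscale0 P : pscale 0 P = 0.
Proof.
apply: polytope_eq; apply/seteqP; split => x /=.
  by move=> [p Pp <-]; rewrite scale0r.
by have [p Pp] := polytope_neq0 P; move=> ->; exists p => //; rewrite scale0r.
Qed.

Lemma pscaleDr a P Q : pscale a (P + Q) = pscale a P + pscale a Q.
Proof.
apply: polytope_eq; apply/seteqP; split => x /=.
  move=> [_ [p Pp [q Qq <-]] <-].
  by exists (a *: p); [exists p|exists (a *: q); [exists q|rewrite scalerDr]].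
move=> [_ [p Pp <-] [_ [q Qq <-] <-]].
by exists (p + q); [exists p => //; exists q|rewrite scalerDr].
Qed.

Lemma pscaleDl a b P : 0 <= a -> 0 <= b ->
  pscale (a + b) P = pscale a P + pscale b P.
Proof.
move=> a0 b0; case: (eqVneq (a + b) 0) => [e|ne0].
  have [-> ->] : a = 0 /\ b = 0.
    by move/eqP: e; rewrite paddr_eq0 // => /andP[/eqP -> /eqP ->].
  by rewrite addr0 !pscale0 addr0.
apply: polytope_eq; apply/seteqP; split => x /=.
  move=> [p Pp <-]; exists (a *: p); first by exists p.
  by exists (b *: p); [exists p|rewrite scalerDl].
move=> [_ [p Pp <-] [_ [q Pq <-] <-]].
exists ((a / (a + b)) *: p + (b / (a + b)) *: q).
  case: (psetP P) Pp Pq => n [v ->]; apply: conv_convex.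
  - by rewrite divr_ge0 // addr_ge0.
  - by rewrite divr_ge0 // addr_ge0.
  - by rewrite -mulrDl divff.
by rewrite scalerDr !scalerA ![(a + b) * _]mulrCA divff // !mulr1.
Qed.

Lemma pointD (s t : E) : point (s + t) = point s + point t.
Proof.
apply: polytope_eq; apply/seteqP; split => x /=.
  by move=> ->; exists s => //; exists t.
by move=> [_ -> [_ -> <-]].
Qed.

Lemma pscale_point a (t : E) : pscale a (point t) = point (a *: t).
Proof.
apply: polytope_eq; apply/seteqP; split => x /=; first by move=> [_ -> <-].
by move=> ->; exists t.
Qed.

Definition dot (x y : E) : R := \sum_i x 0 i * y 0 i.

Definition support P (x : E) : R := sup [set dot y x | y in P].

Lemma dotDl (x y z : E) : dot (x + y) z = dot x z + dot y z.
Proof.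
by rewrite /dot -big_split /=; apply: eq_bigr => i _; rewrite mxE mulrDl.
Qed.

Lemma dotZl a (x z : E) : dot (a *: x) z = a * dot x z.
Proof.
by rewrite /dot mulr_sumr; apply: eq_bigr => i _; rewrite mxE mulrA.
Qed.

Lemma support_max P x : exists2 z, pset P z & forall y, pset P y -> dot y x <= dot z x.
Proof.
case: (psetP P) => n [v ->].
have [i0 _ im] := arg_maxP (fun i => dot (v i) x) (isT : xpredT (ord0 : 'I_n.+1)).
exists (v i0); first exact: conv_gen.
move=> _ [w [w0 w1 ->]].
have -> : dot (\sum_i w i *: v i) x = \sum_i w i * dot (v i) x.
  have dot0 : dot 0 x = 0.
    by rewrite /dot big1 // => i _; rewrite mxE mul0r.
  rewrite (big_morph (dot^~ x) (fun u t => dotDl u t x) dot0).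
  by apply: eq_bigr => i _; rewrite dotZl.
rewrite -[leRHS]mul1r -w1 mulr_suml; apply: ler_sum => i _.
by apply: ler_wpM2l => //; exact: im.
Qed.

Lemma has_sup_support P x : has_sup [set dot y x | y in P].
Proof.
have [z Pz zm] := support_max P x; split; first by exists (dot z x), z.
by exists (dot z x) => _ [y Py <-]; exact: zm.
Qed.

(* The supremum defining the support function is a maximum. *)
Lemma supportE P x z : pset P z -> (forall y, pset P y -> dot y x <= dot z x) ->
  support P x = dot z x.
Proof.
move=> Pz zm; apply/eqP; rewrite eq_le; apply/andP; split.
  by apply: ge_sup; [exists (dot z x), z|move=> _ [y Py <-]; exact: zm].
by apply: ub_le_sup; [case: (has_sup_support P x)|exists z].
Qed.

Lemma supportD P Q x : support (P + Q) x = support P x + support Q x.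
Proof.
have [p Pp pm] := support_max P x; have [q Qq qm] := support_max Q x.
rewrite (supportE Pp pm) (supportE Qq qm) -dotDl; apply: supportE.
  by exists p => //; exists q.
by move=> _ [y Py [z Qz <-]]; rewrite !dotDl lerD // ?pm ?qm.
Qed.

(* The pair (P, Q) stands for the formal difference P - Q. *)
Definition vpoly_rel : rel (polytope * polytope) :=
  fun x y => `[< x.1 + y.2 = y.1 + x.2 >].

Lemma vpoly_rel_refl : reflexive vpoly_rel.
Proof. by move=> x; apply/asboolP. Qed.

Lemma vpoly_rel_sym : symmetric vpoly_rel.
Proof. by move=> x y; apply/asboolP/asboolP => ->. Qed.

Lemma vpoly_rel_trans : transitive vpoly_rel.
Proof.
move=> y x z /asboolP xy /asboolP yz; apply/asboolP.
apply: (@paddI _ _ y.2).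
by rewrite addrAC xy addrAC yz addrAC.
Qed.

Canonical vpoly_equiv :=
  EquivRel vpoly_rel vpoly_rel_refl vpoly_rel_sym vpoly_rel_trans.

Definition vpolytope := {eq_quot vpoly_rel}.

HB.instance Definition _ := EqQuotient.on vpolytope.
HB.instance Definition _ := Choice.on vpolytope.

Definition vdiff P Q : vpolytope := \pi_vpolytope (P, Q).

Lemma vdiff_eq P1 Q1 P2 Q2 :
  vdiff P1 Q1 = vdiff P2 Q2 <-> P1 + Q2 = P2 + Q1.
Proof.
split; first by move=> /eqmodP /asboolP.
by move=> e; apply/eqmodP/asboolP.
Qed.

Lemma vdiff_repr (V : vpolytope) : vdiff (repr V).1 (repr V).2 = V.
Proof. by rewrite /vdiff -surjective_pairing reprK. Qed.

Lemma vpolytopeP (X : vpolytope -> Prop) :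
  (forall P Q, X (vdiff P Q)) -> forall V, X V.
Proof. by move=> h V; rewrite -(vdiff_repr V); exact: h. Qed.

Definition vadd (V W : vpolytope) : vpolytope :=
  vdiff ((repr V).1 + (repr W).1) ((repr V).2 + (repr W).2).

Definition vopp (V : vpolytope) : vpolytope := vdiff (repr V).2 (repr V).1.

Definition vscale a (V : vpolytope) : vpolytope :=
  if 0 <= a then vdiff (pscale a (repr V).1) (pscale a (repr V).2)
  else vdiff (pscale (- a) (repr V).2) (pscale (- a) (repr V).1).

Lemma vaddE P1 Q1 P2 Q2 :
  vadd (vdiff P1 Q1) (vdiff P2 Q2) = vdiff (P1 + P2) (Q1 + Q2).
Proof.
have /vdiff_eq e1 := vdiff_repr (vdiff P1 Q1).
have /vdiff_eq e2 := vdiff_repr (vdiff P2 Q2).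
by apply/vdiff_eq; rewrite addrACA e1 e2 addrACA.
Qed.

Lemma voppE P Q : vopp (vdiff P Q) = vdiff Q P.
Proof.
have /vdiff_eq e := vdiff_repr (vdiff P Q).
by apply/vdiff_eq; rewrite addrC -e addrC.
Qed.

Lemma vscaleE a P Q : vscale a (vdiff P Q) =
  if 0 <= a then vdiff (pscale a P) (pscale a Q)
  else vdiff (pscale (- a) Q) (pscale (- a) P).
Proof.
have /vdiff_eq e := vdiff_repr (vdiff P Q).
rewrite /vscale; case: ifP => _; apply/vdiff_eq; rewrite -!pscaleDr ?e //.
by congr pscale; rewrite addrC -e addrC.
Qed.

Lemma vaddA : associative vadd.
Proof.
by elim/vpolytopeP => ? ?; elim/vpolytopeP => ? ?; elim/vpolytopeP => ? ?;
   rewrite !vaddE !addrA.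
Qed.

Lemma vaddC : commutative vadd.
Proof.
elim/vpolytopeP => P Q; elim/vpolytopeP => P' Q'; rewrite !vaddE.
by rewrite (addrC P) (addrC Q).
Qed.

Lemma vadd0 : left_id (vdiff 0 0) vadd.
Proof. by elim/vpolytopeP => P Q; rewrite vaddE !add0r. Qed.

Lemma vaddN : left_inverse (vdiff 0 0) vopp vadd.
Proof.
elim/vpolytopeP => P Q; rewrite voppE vaddE; apply/vdiff_eq.
by rewrite !(addr0, add0r) addrC.
Qed.

HB.instance Definition _ :=
  GRing.isZmodule.Build vpolytope vaddA vaddC vadd0 vaddN.

(* The two branches of vscale are instances of one formula, valid for any way
   of writing the scalar as a difference of nonnegative numbers. *)
Lemma vscaleB a b P Q : 0 <= a -> 0 <= b ->
  vscale (a - b) (vdiff P Q) =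
  vdiff (pscale a P + pscale b Q) (pscale a Q + pscale b P).
Proof.
move=> a0 b0; rewrite vscaleE; case: ifP => [c0|/negbT].
  have e T : pscale a T = pscale (a - b) T + pscale b T.
    by rewrite -pscaleDl // subrK.
  apply/vdiff_eq; rewrite !e -!addrA; congr (_ + _).
  by rewrite addrC -addrA [RHS]addrCA.
rewrite -ltNge opprB => /ltW; rewrite -oppr_ge0 opprB => c0.
have e T : pscale b T = pscale (b - a) T + pscale a T.
  by rewrite -pscaleDl // subrK.
apply/vdiff_eq; rewrite !e addrA [LHS]addrC [RHS]addrC.
by rewrite [RHS]addrA.
Qed.

Lemma scalar_split a : exists b c, [/\ 0 <= b, 0 <= c & a = b - c].
Proof.
case: (leP 0 a) => [a0|/ltW a0]; first by exists a, 0; rewrite subr0.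
by exists 0, (- a); rewrite oppr_ge0 opprK add0r.
Qed.

Lemma vscaleA a b V : vscale a (vscale b V) = vscale (a * b) V.
Proof.
elim/vpolytopeP: V => P Q.
have [a1 [a2 [a10 a20 ->]]] := scalar_split a.
have [b1 [b2 [b10 b20 ->]]] := scalar_split b.
have -> : (a1 - a2) * (b1 - b2) = (a1 * b1 + a2 * b2) - (a1 * b2 + a2 * b1).
  by ring.
rewrite !vscaleB ?addr_ge0 ?mulr_ge0 //.
rewrite !pscaleDl ?mulr_ge0 // !pscaleDr !pscaleA.
by congr vdiff; rewrite -!addrA; congr (_ + _); rewrite addrA [LHS]addrC.
Qed.

Lemma vscale1 : left_id 1 vscale.
Proof. by elim/vpolytopeP => P Q; rewrite vscaleE ler01 !pscale1. Qed.

Lemma vscaleDr : right_distributive vscale +%R.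
Proof.
move=> a; elim/vpolytopeP => P Q; elim/vpolytopeP => P' Q'.
rewrite [_ + _]vaddE !vscaleE.
by case: ifP => _; rewrite [RHS]vaddE !pscaleDr.
Qed.

Lemma vscaleDl V : {morph vscale^~ V : a b / a + b}.
Proof.
elim/vpolytopeP: V => P Q a b /=.
have [a1 [a2 [a10 a20 ->]]] := scalar_split a.
have [b1 [b2 [b10 b20 ->]]] := scalar_split b.
have -> : (a1 - a2) + (b1 - b2) = (a1 + b1) - (a2 + b2) by ring.
rewrite !vscaleB ?addr_ge0 // [RHS]vaddE !pscaleDl //.
by congr vdiff; rewrite addrACA.
Qed.

HB.instance Definition _ := GRing.Zmodule_isLmodule.Build R vpolytope
  vscaleA vscale1 vscaleDr vscaleDl.

Lemma vdiffD P1 Q1 P2 Q2 :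
  vdiff P1 Q1 + vdiff P2 Q2 = vdiff (P1 + P2) (Q1 + Q2).
Proof. exact: vaddE. Qed.

Lemma vdiffN P Q : - vdiff P Q = vdiff Q P.
Proof. exact: voppE. Qed.

Lemma vdiffZ a P Q : 0 <= a ->
  a *: vdiff P Q = vdiff (pscale a P) (pscale a Q).
Proof. by move=> a0; rewrite [LHS]vscaleE a0. Qed.

(* Independence of the representative is cpwlE. *)
Definition cpwl (V : vpolytope) (x : E) : R :=
  support (repr V).1 x - support (repr V).2 x.

Lemma cpwlE P Q x : cpwl (vdiff P Q) x = support P x - support Q x.
Proof.
have /vdiff_eq e := vdiff_repr (vdiff P Q).
apply/eqP; rewrite /cpwl subr_eq addrAC eq_sym subr_eq eq_sym.
by rewrite -!supportD e.
Qed.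

Definition trans (t : E) : vpolytope := vdiff (point t) 0.

Lemma transD s t : trans (s + t) = trans s + trans t.
Proof. by rewrite /trans vdiffD pointD addr0. Qed.

Lemma trans0 : trans 0 = 0.
Proof. by []. Qed.

Lemma transN t : trans (- t) = - trans t.
Proof.
by apply/eqP; rewrite -addr_eq0 -transD addNr trans0.
Qed.

Lemma transZ a t : trans (a *: t) = a *: trans t.
Proof.
wlog a0 : a t / 0 <= a => [h|].
  case: (leP 0 a) => [/h//|/ltW a0].
  have := h (- a) t; rewrite oppr_ge0 => /(_ a0).
  by rewrite !scaleNr transN => /oppr_inj.
by rewrite /trans vdiffZ // pscale_point pscale_point scaler0.
Qed.

(* Virtual polytopes modulo translation: the quotient of vpolytope by the
   subspace of the classes {t} - {0}. *)
Definition tpoly_rel : rel vpolytope :=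
  fun V W => `[< exists t, V - W = trans t >].

Lemma tpoly_rel_refl : reflexive tpoly_rel.
Proof. by move=> V; apply/asboolP; exists 0; rewrite subrr trans0. Qed.

Lemma tpoly_rel_sym : symmetric tpoly_rel.
Proof.
by move=> V W; apply/asboolP/asboolP => -[t e]; exists (- t);
   rewrite transN -e opprB.
Qed.

Lemma tpoly_rel_trans : transitive tpoly_rel.
Proof.
move=> W V U /asboolP[t e] /asboolP[s f]; apply/asboolP.
by exists (t + s); rewrite transD -e -f addrA subrK.
Qed.

Canonical tpoly_equiv :=
  EquivRel tpoly_rel tpoly_rel_refl tpoly_rel_sym tpoly_rel_trans.

Definition tvpolytope := {eq_quot tpoly_rel}.

HB.instance Definition _ := EqQuotient.on tvpolytope.
HB.instance Definition _ := Choice.on tvpolytope.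

Definition tproj (V : vpolytope) : tvpolytope := \pi_tvpolytope V.

Lemma tproj_eq V W : tproj V = tproj W <-> exists t, V - W = trans t.
Proof.
split; first by move=> /eqmodP /asboolP.
by move=> e; apply/eqmodP/asboolP.
Qed.

Lemma tproj_repr (x : tvpolytope) : tproj (repr x) = x.
Proof. exact: reprK. Qed.

Lemma tvpolytopeP (X : tvpolytope -> Prop) :
  (forall V, X (tproj V)) -> forall x, X x.
Proof. by move=> h x; rewrite -(tproj_repr x); exact: h. Qed.

Definition tadd (x y : tvpolytope) : tvpolytope := tproj (repr x + repr y).
Definition topp (x : tvpolytope) : tvpolytope := tproj (- repr x).
Definition tscale a (x : tvpolytope) : tvpolytope := tproj (a *: repr x).

Lemma taddE V W : tadd (tproj V) (tproj W) = tproj (V + W).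
Proof.
have /tproj_eq[t e] := tproj_repr (tproj V).
have /tproj_eq[s f] := tproj_repr (tproj W).
by apply/tproj_eq; exists (t + s); rewrite transD -e -f opprD addrACA.
Qed.

Lemma toppE V : topp (tproj V) = tproj (- V).
Proof.
have /tproj_eq[t e] := tproj_repr (tproj V).
by apply/tproj_eq; exists (- t); rewrite transN -e opprB opprK addrC.
Qed.

Lemma tscaleE a V : tscale a (tproj V) = tproj (a *: V).
Proof.
have /tproj_eq[t e] := tproj_repr (tproj V).
by apply/tproj_eq; exists (a *: t); rewrite transZ -e scalerBr.
Qed.

Lemma taddA : associative tadd.
Proof.
by elim/tvpolytopeP => ?; elim/tvpolytopeP => ?; elim/tvpolytopeP => ?;
   rewrite !taddE addrA.
Qed.

Lemma taddC : commutative tadd.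
Proof.
by elim/tvpolytopeP => V; elim/tvpolytopeP => W; rewrite !taddE addrC.
Qed.

Lemma tadd0 : left_id (tproj 0) tadd.
Proof. by elim/tvpolytopeP => V; rewrite taddE add0r. Qed.

Lemma taddN : left_inverse (tproj 0) topp tadd.
Proof. by elim/tvpolytopeP => V; rewrite toppE taddE addNr. Qed.

HB.instance Definition _ :=
  GRing.isZmodule.Build tvpolytope taddA taddC tadd0 taddN.

Lemma tscaleA a b x : tscale a (tscale b x) = tscale (a * b) x.
Proof. by elim/tvpolytopeP: x => V; rewrite !tscaleE scalerA. Qed.

Lemma tscale1 : left_id 1 tscale.
Proof. by elim/tvpolytopeP => V; rewrite tscaleE scale1r. Qed.

Lemma tscaleDr : right_distributive tscale +%R.
Proof.
move=> a; elim/tvpolytopeP => V; elim/tvpolytopeP => W.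
by rewrite [_ + _]taddE !tscaleE [RHS]taddE scalerDr.
Qed.

Lemma tscaleDl x : {morph tscale^~ x : a b / a + b}.
Proof.
by elim/tvpolytopeP: x => V a b /=; rewrite !tscaleE [RHS]taddE scalerDl.
Qed.

HB.instance Definition _ := GRing.Zmodule_isLmodule.Build R tvpolytope
  tscaleA tscale1 tscaleDr tscaleDl.

Lemma tprojD V W : tproj (V + W) = tproj V + tproj W.
Proof. by rewrite [RHS]taddE. Qed.

Lemma tprojN V : tproj (- V) = - tproj V.
Proof. by rewrite [RHS]toppE. Qed.

Lemma tprojZ a V : tproj (a *: V) = a *: tproj V.
Proof. by rewrite [RHS]tscaleE. Qed.

Definition tclass P : tvpolytope := tproj (vdiff P 0).

Lemma tclass_eq P Q : tclass P = tclass Q <-> exists t, P = Q + point t.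
Proof.
split=> [/tproj_eq[t]|[t e]].
  rewrite vdiffN vdiffD => /vdiff_eq; rewrite !addr0 add0r => e.
  by exists t; rewrite e addrC.
apply/tproj_eq; exists t; rewrite vdiffN vdiffD; apply/vdiff_eq.
by rewrite e !addr0 add0r addrC.
Qed.

Definition normal_cone (K : polytope) (F : set E) : set E :=
  [set x | forall z, F z -> dot z x = support K x].

Definition normal_fan (K : polytope) : set (set E) :=
  [set C | exists F, [/\ face K F, F !=set0 & C = normal_cone K F]].

Definition compatible (f : E -> R) (fan : set (set E)) : Prop :=
  forall C, fan C -> exists l : {scalar E}, forall x, C x -> f x = l x.

Definition deformation_cone (K : polytope) : set polytope :=
  [set Q | exists (T : polytope) (a : R), 0 < a /\ pscale a K = Q + T].

(* Faces of this set are cut out by functionals on the product of two copies of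
   tvpolytope; these restrict to all functionals on the subspace spanned by
   the translation classes of deformation_cone K. *)
Definition rep_polyhedron (K : polytope) (V : vpolytope) :
    set (tvpolytope * tvpolytope) :=
  [set x | exists P Q : polytope,
     [/\ deformation_cone K P, deformation_cone K Q,
         x = (tclass P, tclass Q) & tproj V = tclass P - tclass Q]].

(* Vertex sets of polytopes are finite, so #<= compares numbers of vertices and
   ~~ (A #<= B) says that B has strictly fewer elements than A. *)
Definition minimal_representative (K : polytope) (V : vpolytope)
    (P Q : polytope) : Prop :=
  rep_polyhedron K V (tclass P, tclass Q) /\
  ~ exists P' Q' : polytope,
    [/\ rep_polyhedron K V (tclass P', tclass Q'),
        vertices P' #<= vertices P, vertices Q' #<= vertices Q &
        ~~ (vertices P #<= vertices P') \/ ~~ (vertices Q #<= vertices Q')].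

End Polytopes.

(* Main.v *)
From HB Require Import structures.
Require Import Defs.
From mathcomp Require Import all_boot all_order all_algebra.
From mathcomp Require Import boolp classical_sets functions cardinality reals.
From mathcomp Require Import ring lra.

(** Write K as the convex hull of its vertices v_i, each one the strict
    maximiser over K of some direction x_i, and let N_i be the normal cone of
    K at v_i.  A polytope of the deformation cone of K is the same thing as a
    family of points a_i such that a_i maximises over the family every
    direction of N_i ([adapted_deformation], [deformation_adapted]); the a_i
    are its vertices, and a_i is its only maximiser in the direction x_i
    ([adapted_exposed]).  The polytope determines the family ([hull_inj]),
    Minkowski sum is addition of families ([hullD]), so the deformation cone
    becomes a convex cone of families, closed under limits and given by linear
    inequalities.

    The exposing functional.  Let (P, Q) be minimal, with families p and q.
    For a polytope A with support function f_A, the gap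
    f_A(x_i) + f_A(x_j) - f_A(x_i + x_j) is nonnegative, linear in the
    translation class of A, and vanishes for A in the deformation cone exactly
    when a_i = a_j ([gap_hull_eq0]).  Summing the gaps of A over the pairs with
    p_i = p_j and those of B over the pairs with q_i = q_j gives a linear
    function of (A, B) that is nonnegative on the representative polyhedron,
    zero at (P, Q), and zero only at those (A, B) for which a collapses all
    that p collapses and b all that q collapses ([gap_sum_eq0]).

    Uniqueness.  For such an (A, B), equality of the differences A - B and
    P - Q says that a - p and b - q agree up to a constant; call it D.  If D is
    constant then (A, B) is a translate of (P, Q).  Otherwise follow
    (p + s D, q + s D), which keeps representing the same virtual polytope.
    The two families cannot stay adapted for all real s, because then D and
    - D would both be adapted, which forces D to be constant.  At the last
    admissible s in one direction some two distinct vertices must have merged: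
    as long as the vertices stay distinct, the motion can be continued
    ([adapted_extend]).  Merging means that one of the two polytopes has lost a
    vertex while neither has gained any, against minimality
    ([minimal_rigid]).

    The continuation step and the description of the deformation cone are both
    instances of one perturbation principle for linear inequalities on the
    polyhedral cones N_i ([adapted_perturb]), a consequence of the lemma of
    Farkas. *)

Set Implicit Arguments.
Unset Strict Implicit.
Unset Printing Implicit Defensive.

Import Order.TTheory GRing.Theory Num.Theory.
Local Open Scope ring_scope.
Local Open Scope classical_set_scope.
Local Open Scope card_scope.

(** * The lemma of Farkas and separation from a convex hull *)

(** Induction on the number of functionals.  If the first one, h, cannot be
    dropped, there is a z at which b is positive and only h is positive.
    Projecting along z onto the kernel of h removes h, and the expression
    obtained there lifts back, the coefficient of h being nonnegative because
    of the values at z. *)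
Lemma farkas (R : realType) (E : lmodType R) n (g : 'I_n -> E -> R) (b : E -> R) :
  (forall k, scalar (g k)) -> scalar b ->
  (forall y, (forall k, g k y <= 0) -> b y <= 0) ->
  exists w : 'I_n -> R, (forall k, 0 <= w k) /\
    forall y, b y = \sum_k w k * g k y.
Proof.
elim: n g b => [|n IH] g b gl bl H.
  exists (fun=> 0); split => // y; rewrite big_ord0.
  have b0 : b 0 = 0.
    by have := bl 1 0 0; rewrite scale1r addr0 mul1r => /eqP;
      rewrite -subr_eq subrr => /eqP <-.
  have bN : b y + b (- y) = 0.
    by have := bl 1 y (- y); rewrite scale1r subrr b0 mul1r.
  have Hy z : b z <= 0 by apply: H => -[].
  by have := Hy y; have := Hy (- y); lra.
pose g' (k : 'I_n) := g (lift ord0 k).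
have [Hb|/existsNP[z /not_implyP[gz /negP]]] :=
    pselect (forall y, (forall k, g' k y <= 0) -> b y <= 0).
  have [w [w0 wE]] := IH g' b (fun k => gl _) bl Hb.
  exists (fun k => if unlift ord0 k is Some j then w j else 0); split.
    by move=> k; case: unliftP.
  move=> y; rewrite big_ord_recl unlift_none mul0r add0r wE.
  by apply: eq_bigr => k _; rewrite liftK.
rewrite -ltNge => bz.
set h := g ord0; have hl : scalar h := gl ord0.
have hz : 0 < h z.
  rewrite ltNge; apply/negP => hz; move: bz; rewrite ltNge => /negP; apply.
  by apply: H => k; case: (unliftP ord0 k) => [j ->|-> //]; exact: gz.
(* pr l is l composed with the projection onto the kernel of h along z. *)
pose pr (l : E -> R) y := l y - l z / h z * h y.
have prE l y : scalar l -> pr l y = l (- (h y / h z) *: z + y).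
  by move=> ->; rewrite /pr; ring.
have prl l : scalar l -> scalar (pr l).
  by move=> ll a u v; rewrite /pr ll hl; ring.
have [||y Hy|w [w0 wE]] := IH (fun k => pr (g' k)) (pr b).
- by move=> k; apply: prl; exact: gl.
- exact: prl.
- rewrite prE //; apply: H => k; case: (unliftP ord0 k) => [j ->|->].
    by rewrite -prE ?Hy.
  by rewrite -/h hl mulNr divfK ?gt_eqF // addNr.
pose c := (b z - \sum_j w j * g' j z) / h z.
exists (fun k => if unlift ord0 k is Some j then w j else c); split.
  move=> k; case: unliftP => // _.
  rewrite divr_ge0 ?ltW // subr_gt0 (@le_lt_trans _ _ 0) ?bz //.
  by apply: sumr_le0 => j _; rewrite mulr_ge0_le0.
move=> y; rewrite big_ord_recl unlift_none.
rewrite (eq_bigr (fun k => w k * g' k y)); last by move=> k _; rewrite liftK.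
move: (wE y); rewrite /pr => /eqP; rewrite subr_eq => /eqP ->.
rewrite (eq_bigr _ (fun k _ => mulrBr _ _ _)) sumrB -/h /c.
have -> : \sum_i w i * (g' i z / h z * h y) = (\sum_i w i * g' i z) / h z * h y.
  by rewrite !mulr_suml; apply: eq_bigr => i _; ring.
ring.
Qed.

Section Separation.
Variables (R : realType) (d : nat).
Notation E := 'rV[R]_d.

Lemma dotBl (x y z : E) : dot (x - y) z = dot x z - dot y z.
Proof. by rewrite dotDl -scaleN1r dotZl mulN1r. Qed.

Lemma dotC (x y : E) : dot x y = dot y x.
Proof. by apply: eq_bigr => i _; rewrite mulrC. Qed.

Lemma dotDr (x y z : E) : dot x (y + z) = dot x y + dot x z.
Proof. by rewrite !(dotC x) dotDl. Qed.

Lemma dotZr a (x y : E) : dot x (a *: y) = a * dot x y.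
Proof. by rewrite !(dotC x) dotZl. Qed.

Lemma dot0l (y : E) : dot 0 y = 0.
Proof. by rewrite -(scale0r 0) dotZl mul0r. Qed.

Lemma dot_suml (I : finType) (w : I -> R) (v : I -> E) y :
  dot (\sum_i w i *: v i) y = \sum_i w i * dot (v i) y.
Proof.
rewrite (big_morph (fun u => dot u y) (fun u t => dotDl u t y) (dot0l y)).
by apply: eq_bigr => i _; rewrite dotZl.
Qed.

Lemma dot_inj (x z : E) : (forall y, dot x y = dot z y) -> x = z.
Proof.
move=> H; apply/rowP => j.
have dE (u : E) : dot u (delta_mx 0 j) = u 0 j.
  rewrite /dot (bigD1 j) //= mxE !eqxx mulr1 big1 ?addr0 // => i /negPf ij.
  by rewrite mxE ij andbF mulr0.
by rewrite -!dE H.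
Qed.

Lemma conv_dot_le (I : finType) (v : I -> E) y m z :
  conv v z -> (forall i, dot (v i) y <= m) -> dot z y <= m.
Proof.
move=> [w [w0 w1 ->]] H; rewrite dot_suml -[m]mul1r -w1 mulr_suml.
by apply: ler_sum => i _; apply: ler_wpM2l.
Qed.

Lemma conv_dot_lt (I : finType) (v : I -> E) y m z :
  conv v z -> (forall i, dot (v i) y < m) -> dot z y < m.
Proof.
move=> [w [w0 w1 ->]] H; rewrite dot_suml -subr_gt0 -[m]mul1r -w1 mulr_suml.
have t0 i : 0 <= w i * m - w i * dot (v i) y.
  by rewrite -mulrBr mulr_ge0 // subr_ge0 ltW.
rewrite -sumrB lt_neqAle sumr_ge0 // andbT eq_sym psumr_eq0 //.
apply/negP => /allP w_eq0; move/eqP: w1.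
rewrite big1 ?(eq_sym 0) ?oner_eq0 // => i _.
have := w_eq0 i; rewrite mem_index_enum -mulrBr mulf_eq0 subr_eq0 => /(_ isT).
by rewrite [m == _]gt_eqF // orbF => /eqP.
Qed.

(** Homogenisation: the functional (y, s) |-> <z, y> + s is tested against
    those of the v j.  Evaluating a Farkas certificate at (0, 1) says that its
    weights sum to 1, at (y, 0) that they express z. *)
Lemma conv_separation n (v : 'I_n -> E) z :
  ~ conv v z -> exists y, forall j, dot (v j) y < dot z y.
Proof.
move=> nz; apply: contrapT => nsep; apply: nz.
pose aff (a : E) (u : E * R^o) : R := dot a u.1 + u.2.
have affl a : scalar (aff a).
  move=> c s t; rewrite /aff /= dotDr dotZr mulrDr addrACA.
  by congr (_ + _ + (_ + _)).
have [u ulo|w [w0 wE]] := @farkas R (E * R^o)%type n (fun k => aff (v k)) (aff z)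
    (fun k => affl _) (affl z).
  rewrite leNgt; apply/negP => uhi; apply: nsep; exists u.1 => j.
  by have := ulo j; move: uhi; rewrite /aff; lra.
exists w; split => //.
  have := wE (0, 1); rewrite /aff /=.
  have d0 a : dot a (0 : E) = 0 by rewrite dotC dot0l.
  by rewrite d0 add0r => ->; apply: eq_bigr => k _; rewrite d0 add0r mulr1.
apply: dot_inj => y; have := wE (y, 0); rewrite /aff /= addr0 => ->.
by rewrite dot_suml; apply: eq_bigr => k _; rewrite addr0.
Qed.

(** In a generating family of least size no generator lies in the hull of the
    others, and separating it from them gives the direction. *)
Lemma exposed_generators (K : set E) : is_polytope K ->
  exists n (v x : 'I_n.+1 -> E), K = conv v /\
    forall i j, j != i -> dot (v j) (x i) < dot (v i) (x i).
Proof.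
move=> pK.
have ex : exists n, `[< exists v : 'I_n.+1 -> E, K = conv v >].
  by have [n [v e]] := pK; exists n; apply/asboolP; exists v.
case: (ex_minnP ex) => n /asboolP[v KE] nmin.
suff H i : exists y, forall j, j != i -> dot (v j) y < dot (v i) y.
  by have [x xP] := choice H; exists n, v, x.
have [|y yP] := @conv_separation n (v \o lift i) (v i); last first.
  exists y => j ij; case: (unliftP i j) (ij) => [k -> _|->]; first exact: yP.
  by rewrite eqxx.
move=> vi.
(* Otherwise v i is redundant, against the choice of n. *)
have {}KE : K = conv (v \o lift i).
  rewrite KE; apply/seteqP; split => z.
    move=> zv; apply: contrapT => /conv_separation[y yP].
    have viy := conv_dot_lt vi yP.
    have vy k : dot (v k) y < dot z y.
      by case: (unliftP i k) => [l ->|->//]; exact: yP.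
    by have := conv_dot_lt zv vy; rewrite ltxx.
  move=> [w [w0 w1 ->]]; exists (fun k => if unlift i k is Some j then w j else 0).
  split.
  - by move=> k; case: unliftP.
  - rewrite (bigD1_ord i) //= unlift_none add0r -w1.
    by apply: eq_bigr => k _; rewrite liftK.
  - rewrite (bigD1_ord i) //= unlift_none scale0r add0r.
    by apply: eq_bigr => k _; rewrite liftK.
case: n v i vi KE nmin {ex} => [v i|n v i] vi KE nmin.
  by have [w [_ + _]] := vi; rewrite big_ord0 => /eqP; rewrite eq_sym oner_eq0.
have := nmin n; rewrite ltnn => /(_ _)/negP; apply => //.
by apply/asboolP; exists (v \o lift i).
Qed.

End Separation.

(** * Families adapted to the normal cones of a polytope *)

Section Adapted.
Variables (R : realType) (d n : nat).
Notation E := 'rV[R]_d.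
Notation family := ('I_n.+1 -> 'rV[R]_d).
Implicit Types (v x c D : family).

Definition hull c : polytope R d := Polytope (conv_is_polytope ord0 c).

(** The normal cone of hull c at its point c i. *)
Definition in_cone c i (y : E) : Prop := forall j, dot (c j) y <= dot (c i) y.

(** The function equal to <c i, .> on the normal cone of v i is then a
    well-defined support function, linear on the cones of the normal fan
    of the hull of v. *)
Definition adapted v c : Prop := forall i y, in_cone v i y -> in_cone c i y.

Definition exposes x v : Prop :=
  forall i j, j != i -> dot (v j) (x i) < dot (v i) (x i).

Lemma in_cone_cover v y : exists i, in_cone v i y.
Proof.
have [i _ im] := arg_maxP (fun k => dot (v k) y) (isT : xpredT (ord0 : 'I_n.+1)).
by exists i => j; exact: im.
Qed.

Lemma exposes_in_cone x v i : exposes x v -> in_cone v i (x i).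
Proof. by move=> xv j; have [->|/xv/ltW] := eqVneq j i. Qed.

Lemma hull_dot_le c i y z : in_cone c i y -> conv c z -> dot z y <= dot (c i) y.
Proof. by move=> ci cz; apply: conv_dot_le cz ci. Qed.

Lemma hullP c z : (forall y, exists2 i, in_cone c i y & dot z y <= dot (c i) y) ->
  conv c z.
Proof.
move=> H; apply: contrapT => /conv_separation[y yP].
by have [i _] := H y; rewrite leNgt yP.
Qed.

Lemma support_hull c i y : in_cone c i y -> Defs.support (hull c) y = dot (c i) y.
Proof.
move=> ci; apply: Defs.supportE => [|z]; first exact: conv_gen.
exact: hull_dot_le.
Qed.

Lemma adaptedD v c c' : adapted v c -> adapted v c' ->
  adapted v (fun i => c i + c' i).
Proof.
by move=> cA cA' i y yi j; rewrite !dotDl lerD // ?cA ?cA'.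
Qed.

Lemma adaptedZ v c a : 0 <= a -> adapted v c -> adapted v (fun i => a *: c i).
Proof.
by move=> a0 cA i y yi j; rewrite !dotZl ler_wpM2l // cA.
Qed.

Lemma hullZ c a : pscale a (hull c) = hull (fun i => a *: c i).
Proof.
apply: polytope_eq; apply/seteqP; split => z /=.
  move=> [_ [w [w0 w1 ->]] <-]; exists w; split => //.
  by rewrite scaler_sumr; apply: eq_bigr => i _; rewrite !scalerA mulrC.
move=> [w [w0 w1 ->]]; exists (\sum_i w i *: c i); first by exists w.
by rewrite scaler_sumr; apply: eq_bigr => i _; rewrite !scalerA mulrC.
Qed.

(** This fails for arbitrary families: the left side contains all c i + c' j.
    Here no direction sees such a point outside the right side, since c and c'
    are maximal at a common index. *)
Lemma hullD v c c' : adapted v c -> adapted v c' ->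
  hull c + hull c' = hull (fun i => c i + c' i).
Proof.
move=> cA cA'; apply: polytope_eq; apply/seteqP; split => z.
  move=> [p cp [q cq <-]]; apply: hullP => y.
  have [i yi] := in_cone_cover v y; exists i; first exact: adaptedD yi.
  by rewrite !dotDl lerD // hull_dot_le //; [apply: cA|apply: cA'].
move=> [w [w0 w1 ->]].
exists (\sum_i w i *: c i); first by exists w.
exists (\sum_i w i *: c' i); first by exists w.
by rewrite -big_split; apply: eq_bigr => i _; rewrite scalerDr.
Qed.

(** Only finitely many thresholds have to be exceeded. *)
Lemma eventually_all (I : finType) (P : I -> R -> Prop) :
  (forall i, exists a0, forall a, a0 <= a -> P i a) ->
  exists2 a, 0 < a & forall i, P i a.
Proof.
move=> /choice[f fP]; exists (1 + \sum_i `|f i|).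
  by rewrite ltr_pwDl // sumr_ge0.
move=> i; apply: fP; rewrite (bigD1 i) //= (le_trans (ler_norm _)) //.
by rewrite addrCA lerDl addr_ge0 // sumr_ge0.
Qed.

(** On the polyhedral cone N_i of v, the functional <c i - c j, .> is
    nonnegative and <D i - D j, .> is nonnegative where it vanishes.  A Farkas
    certificate then bounds - <D i - D j, .> by a multiple of
    <c i - c j, .> on the whole of N_i. *)
Lemma adapted_perturb v c D : adapted v c ->
  (forall i j y, in_cone v i y -> dot (c j) y = dot (c i) y ->
    dot (D j) y <= dot (D i) y) ->
  exists2 a, 0 < a & adapted v (fun i => a *: c i + D i).
Proof.
move=> cA cD.
have [[i j]|a a0 aP] := @eventually_all ('I_n.+1 * 'I_n.+1)%type (fun ij a =>
  forall y, in_cone v ij.1 y -> dot (a *: c ij.2 + D ij.2) y <=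
    dot (a *: c ij.1 + D ij.1) y); last first.
  by exists a => // i y yi j; exact: (aP (i, j)).
pose g (k : 'I_n.+2) : E -> R :=
  if unlift ord0 k is Some l then dot (v l - v i) else dot (c i - c j).
have dotl (u : E) : scalar (dot u) by move=> a s t; rewrite dotDr dotZr.
have [k|y gy|w [w0 wE]] := @farkas R _ n.+2 g (dot (D j - D i)) _ (dotl _).
- by rewrite /g; case: unliftP.
- have yi : in_cone v i y.
    by move=> k; have := gy (lift ord0 k); rewrite /g liftK dotBl subr_le0.
  have := gy ord0; rewrite /g unlift_none !dotBl !subr_le0 => cij.
  by apply: cD => //; apply/eqP; rewrite eq_le cij (cA _ _ yi).
exists (w ord0) => a wa y /= yi; have := wE y.
rewrite big_ord_recl; set S := \sum_(_ < _) _; rewrite {1}/g unlift_none.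
have S0 : S <= 0.
  apply: sumr_le0 => k _; rewrite mulr_ge0_le0 // /g liftK dotBl subr_le0.
  exact: yi.
have := ler_wpM2r (_ : 0 <= dot (c i) y - dot (c j) y) wa.
rewrite subr_ge0 (cA _ _ yi) => /(_ isT).
by move: S0; rewrite !dotBl !dotDl !dotZl; lra.
Qed.

(** The family of the complementary Minkowski summand of c in a dilate of
    hull v. *)
Lemma adapted_complement v c : adapted v c ->
  exists2 a, 0 < a & adapted v (fun i => a *: v i - c i).
Proof.
move=> cA; apply: (@adapted_perturb v v (fun i => - c i)) => // i j y yi vij.
have yj : in_cone v j y by move=> k; rewrite vij; exact: yi.
by rewrite -!scaleN1r !dotZl !mulN1r lerN2 cA.
Qed.

Lemma adapted_deformation v c : adapted v c ->
  deformation_cone (hull v) (hull c).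
Proof.
move=> cA; have [a a0 tA] := adapted_complement cA.
exists (hull (fun i => a *: v i - c i)), a; split => //.
rewrite (hullD cA tA) hullZ; congr hull; apply: funext => i.
by rewrite addrC subrK.
Qed.

(** A vertex of a dilate of hull v decomposes along the Minkowski sum Q + T; its
    components in Q form the family. *)
Lemma deformation_adapted v (Q : polytope R d) : deformation_cone (hull v) Q ->
  exists2 c, adapted v c & Q = hull c.
Proof.
move=> [T [a [a0 e]]].
have H i : exists q : E * E, [/\ pset Q q.1, pset T q.2 & a *: v i = q.1 + q.2].
  have : pset (pscale a (hull v)) (a *: v i) by exists (v i) => //; exact: conv_gen.
  by rewrite e => -[p Pp [t Tt pt]]; exists (p, t).
have [f fP] := choice H; pose c i := (f i).1.
have cmax i y z : in_cone v i y -> pset Q z -> dot z y <= dot (c i) y.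
  move=> yi Qz; have [_ Tt ve] := fP i.
  have : pset (pscale a (hull v)) (z + (f i).2).
    by rewrite e; exists z => //; exists (f i).2.
  move=> [u hu uE]; have := hull_dot_le yi hu.
  rewrite -(ler_pM2l a0) -!dotZl uE ve !dotDl.
  by rewrite lerD2r.
have cA : adapted v c.
  by move=> i y yi j; apply: cmax => //; have [] := fP j.
exists c => //; apply: polytope_eq; apply/seteqP; split => z.
  move=> Qz; apply: hullP => y; have [i yi] := in_cone_cover v y.
  by exists i; [exact: cA|exact: cmax].
have [m [u Qu]] := psetP Q; rewrite Qu => cz; apply: contrapT.
move=> /conv_separation[y yP]; have [i yi] := in_cone_cover v y.
have [Qi _ _] := fP i; have := hull_dot_le (cA _ _ yi) cz.
rewrite leNgt (@conv_dot_lt _ _ _ u y) -?Qu //.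
Qed.

Lemma exposed_hull x v i z : exposes x v -> conv v z ->
  dot (v i) (x i) <= dot z (x i) -> z = v i.
Proof.
move=> xv [w [w0 w1 ->]]; rewrite dot_suml => iz.
have w_i j : j != i -> w j = 0.
  move=> ji; apply/eqP; rewrite eq_le w0 andbT leNgt; apply/negP => wj.
  move: iz; apply/negP; rewrite -ltNge -[ltRHS]mul1r -w1 mulr_suml.
  rewrite (bigD1 j) //= [ltRHS](bigD1 j) //= ltr_leD ?ltr_pM2l ?xv //.
  by apply: ler_sum => k _; apply: ler_wpM2l => //; exact: exposes_in_cone.
move: w1; rewrite (bigD1 i) //= big1 ?addr0 => [wi|j /w_i//].
rewrite (bigD1 i) //= wi scale1r big1 ?addr0 // => j /w_i ->.
by rewrite scale0r.
Qed.

(** Adding the complementary summand turns a maximiser of hull c in direction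
    x i into one of a dilate of hull v, where it is unique. *)
Lemma adapted_exposed x v c i z : exposes x v -> adapted v c -> conv c z ->
  dot (c i) (x i) <= dot z (x i) -> z = c i.
Proof.
move=> xv cA cz iz; have [a a0 tA] := adapted_complement cA.
have : pset (hull c + hull (fun i => a *: v i - c i)) (z + (a *: v i - c i)).
  by exists z => //; exists (a *: v i - c i) => //; exact: conv_gen.
have ce : (fun i => c i + (a *: v i - c i)) = (fun i => a *: v i).
  by apply: funext => k; rewrite addrC subrK.
rewrite (hullD cA tA) ce => /(@exposed_hull x _ i).
have ax : exposes x (fun i => a *: v i).
  by move=> k j kj; rewrite !dotZl ltr_pM2l // xv.
move=> /(_ ax); rewrite dotDl dotBl addrCA lerDl subr_ge0 => /(_ iz).
by rewrite addrCA -[RHS]addr0 => /addrI/eqP; rewrite subr_eq0 => /eqP.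
Qed.

Lemma hull_inj x v c c' : exposes x v -> adapted v c -> adapted v c' ->
  hull c = hull c' -> c = c'.
Proof.
move=> xv cA cA' /(congr1 (@pset R d)); rewrite [LHS]/= [RHS]/= => e.
apply: funext => i; have xi := exposes_in_cone i xv.
apply: (adapted_exposed xv cA'); first by rewrite -e; exact: conv_gen.
by apply: hull_dot_le; [exact: cA|rewrite /= e; exact: conv_gen].
Qed.

Lemma dotl_scalar (u : E) : scalar (fun z => dot z u).
Proof. by move=> a s t; rewrite dotDl dotZl. Qed.

(** The c i may repeat, so that the number of vertices of hull c is the number
    of distinct values of c. *)
Lemma vertices_hull x v c : exposes x v -> adapted v c ->
  vertices (hull c) = range c.
Proof.
move=> xv cA; apply/seteqP; split => [z [l lP]|_ [i _ <-]].
  have [cz zmax] : [set y | conv c y /\ forall y', conv c y' -> l y' <= l y] z.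
    by rewrite -lP.
  have [i _ im] := arg_maxP (fun k => l (c k)) (isT : xpredT (ord0 : 'I_n.+1)).
  exists i => //; suff : [set z] (c i) by [].
  rewrite lP; split; first exact: conv_gen.
  move=> _ [w [w0 w1 ->]]; rewrite linear_sum -[leRHS]mul1r -w1 mulr_suml /=.
  apply: ler_sum => k _; rewrite linearZ; apply: ler_wpM2l => //; exact: im.
have lin := GRing.isLinear.Build R E R *%R _ (dotl_scalar (x i)).
pose l : {scalar E} := HB.pack (fun z : E => dot z (x i)) lin.
exists l; have xi := cA _ _ (exposes_in_cone i xv).
apply/seteqP; split => [_ ->|z [cz zmax]] /=.
  by split=> [|y]; [exact: conv_gen|exact: hull_dot_le].
by apply: (adapted_exposed xv cA) => //; apply: zmax; exact: conv_gen.
Qed.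

(** The normal cone of hull c at c j is the union of the cones N_k of v with
    c k = c j.  To find k, move y slightly towards x j, which forces c k = c j:
    among the v k maximal in direction y take one that is maximal in
    direction x j. *)
Lemma in_cone_refine x v c j y : exposes x v -> adapted v c -> in_cone c j y ->
  exists2 k, in_cone v k y & c k = c j.
Proof.
move=> xv cA yj.
have [i0 yi0] := in_cone_cover v y.
pose top := [pred k | dot (v k) y == dot (v i0) y].
have [k /eqP ktop kmax] := arg_maxP (fun k => dot (v k) (x j)) (eqxx _ : top i0).
have yk : in_cone v k y by move=> l; rewrite ktop.
exists k => //.
(* v k is maximal in direction a *: y + x j for a large. *)
have [l|a a0 aP] := @eventually_all 'I_n.+1 (fun l a =>
    dot (v l) (a *: y + x j) <= dot (v k) (a *: y + x j)).
  case: (eqVneq (dot (v l) y) (dot (v i0) y)) => [lt|nlt].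
    by exists 0 => a _; rewrite !dotDr !dotZr lt ktop lerD2l; exact/kmax/eqP.
  have lk : 0 < dot (v k) y - dot (v l) y.
    by rewrite subr_gt0 lt_neqAle ktop nlt yi0.
  exists ((dot (v l) (x j) - dot (v k) (x j)) / (dot (v k) y - dot (v l) y)) => a.
  by rewrite ler_pdivrMr // !dotDr !dotZr; lra.
have cka := cA _ _ aP.
have xj := cA _ _ (exposes_in_cone j xv).
apply: (adapted_exposed xv cA); first exact: conv_gen.
have := cka j; rewrite !dotDr !dotZr.
have := ler_wpM2l (ltW a0) (yj k).
by lra.
Qed.

End Adapted.

(** * Moving a family until two of its points merge *)

Section Collapse.
Variables (R : realType) (d n : nat).
Notation E := 'rV[R]_d.
Notation family := ('I_n.+1 -> 'rV[R]_d).
Implicit Types (v x c p q D : family).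

Definition shift c D (s : R) : family := fun i => c i + s *: D i.

(** When c and D are adapted, this says that the normal fan of hull D coarsens
    that of hull c. *)
Definition coarser c D : Prop := forall i j, c i = c j -> D i = D j.

Definition collapses c c' : Prop := exists i j, c i <> c j /\ c' i = c' j.

(** The functionals <D i, .> glue to a function linear on each normal cone of
    the hull of v, not necessarily a convex one; differences of adapted families
    are of this kind. *)
Definition cone_linear v D : Prop := forall i j y,
  in_cone v i y -> in_cone v j y -> dot (D i) y = dot (D j) y.

Lemma adapted_cone_linear v c : adapted v c -> cone_linear v c.
Proof.
by move=> cA i j y yi yj; apply/eqP; rewrite eq_le (cA _ _ yi) (cA _ _ yj).
Qed.

Lemma dot_shift c D s i y : dot (shift c D s i) y = dot (c i) y + s * dot (D i) y.
Proof. by rewrite dotDl dotZl. Qed.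

Lemma adapted_segment v c D s t : adapted v c -> adapted v (shift c D s) ->
  0 <= t <= s -> adapted v (shift c D t).
Proof.
move=> cA sA /andP[t0 ts] i y yi j; have := sA _ _ yi j; have := cA _ _ yi j.
rewrite !dot_shift; case: (leP (dot (D j) y) (dot (D i) y)) => [Dij|/ltW Dij].
  by have := ler_wpM2l t0 Dij; lra.
by have := ler_wpM2r (_ : 0 <= dot (D j) y - dot (D i) y) ts;
  rewrite subr_ge0 => /(_ Dij); lra.
Qed.

(** Each defining inequality is affine in s, hence preserved by suprema. *)
Lemma adapted_sup v c D (S : set R) : has_sup S -> S 0 ->
  (forall s, S s -> adapted v (shift c D s)) -> adapted v (shift c D (sup S)).
Proof.
move=> supS S0 SA i y yi j; rewrite !dot_shift.
have Sy s : S s -> dot (c j) y + s * dot (D j) y <= dot (c i) y + s * dot (D i) y.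
  by move=> Ss; have := SA s Ss i y yi j; rewrite !dot_shift.
have c0 := Sy 0 S0; rewrite !mul0r !addr0 in c0.
have s0 : 0 <= sup S by apply: ub_le_sup => //; case: supS.
case: (leP (dot (D j) y) (dot (D i) y)) => [Dij|].
  by have := ler_wpM2l s0 Dij; lra.
rewrite -subr_gt0 => Dij.
suff : sup S <= (dot (c i) y - dot (c j) y) / (dot (D j) y - dot (D i) y).
  by rewrite ler_pdivlMr //; lra.
apply: ge_sup; first by case: supS.
by move=> s /Sy; rewrite ler_pdivlMr //; lra.
Qed.

(** The slope in s of an inequality that holds on a whole ray is nonnegative. *)
Lemma adapted_ray v c D :
  (forall s, 0 <= s -> adapted v (shift c D s)) -> adapted v D.
Proof.
move=> cA i y yi j; rewrite leNgt; apply/negP; rewrite -subr_gt0 => Dij.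
pose s := (`|dot (c i) y - dot (c j) y| + 1) / (dot (D j) y - dot (D i) y).
have s0 : 0 <= s by rewrite divr_ge0 ?(ltW Dij) // addr_ge0.
have := cA s s0 i y yi j; rewrite !dot_shift.
have : s * (dot (D j) y - dot (D i) y) = `|dot (c i) y - dot (c j) y| + 1.
  by rewrite /s divfK // gt_eqF.
have := ler_norm (dot (c i) y - dot (c j) y).
by lra.
Qed.

(** Where y is maximal at both c i and c j, it lies in a cone N_k with
    c k = c j, hence D k = D j; since D is linear across N_i and N_k, the
    inequality for D at y is an equality.  So the perturbation principle
    applies. *)
Lemma adapted_extend x v c D : exposes x v -> adapted v c ->
  cone_linear v D -> coarser c D ->
  exists2 e, 0 < e & adapted v (shift c D e).
Proof.
move=> xv cA DL cD; have [i j y yi cij|a a0 aA] := @adapted_perturb R d n v c D cA.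
  have yj : in_cone c j y by move=> k; rewrite cij; exact: cA.
  have [k yk ckj] := in_cone_refine xv cA yj.
  by rewrite -(cD _ _ ckj) (DL _ _ _ yk yi).
exists a^-1; first by rewrite invr_gt0.
have := adaptedZ (_ : 0 <= a^-1) aA; rewrite invr_ge0 (ltW a0) => /(_ isT).
congr (adapted v _); apply: funext => i.
by rewrite scalerDr scalerA mulVf ?gt_eqF // scale1r.
Qed.

Lemma shift_coarser c D s : coarser c D -> coarser c (shift c D s).
Proof. by move=> cD i j cij; rewrite /shift cij (cD _ _ cij). Qed.

Lemma coarser_shift c D s : coarser c D -> ~ collapses c (shift c D s) ->
  coarser (shift c D s) D.
Proof.
move=> cD nc i j sij; apply: cD; apply: contrapT => cij; apply: nc.
by exists i, j.
Qed.

(** The value sought is the supremum t of the admissible s.  It is attained, and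
    if nothing merged at t then both families could be moved further. *)
Lemma first_collapse x v p q D s0 : exposes x v -> adapted v p -> adapted v q ->
  cone_linear v D -> coarser p D -> coarser q D ->
  0 <= s0 -> ~ (adapted v (shift p D s0) /\ adapted v (shift q D s0)) ->
  exists s, [/\ adapted v (shift p D s), adapted v (shift q D s) &
    collapses p (shift p D s) \/ collapses q (shift q D s)].
Proof.
move=> xv pA qA DL pD qD s00 nA.
have c0 c : shift c D 0 = c.
  by apply: funext => i; rewrite /shift scale0r addr0.
pose S := [set s | 0 <= s /\ adapted v (shift p D s) /\ adapted v (shift q D s)].
have S0 : S 0 by rewrite /S /= !c0.
have Sub : ubound S s0.
  move=> s [_ [sp sq]]; rewrite leNgt; apply/negP => ss0; apply: nA.
  by split; apply: (@adapted_segment _ _ _ s) => //; rewrite s00 ltW.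
have supS : has_sup S by split; [exists 0|exists s0].
set t := sup S.
have tp : adapted v (shift p D t) by apply: adapted_sup => // s [_ []].
have tq : adapted v (shift q D t) by apply: adapted_sup => // s [_ []].
exists t; split=> //; apply: contrapT => /not_orP[ncp ncq].
have [e e0 eA] := adapted_extend xv tp DL (coarser_shift pD ncp).
have [f f0 fA] := adapted_extend xv tq DL (coarser_shift qD ncq).
have shiftD c s r : shift (shift c D s) D r = shift c D (s + r).
  by apply: funext => i; rewrite /shift scalerDl addrA.
pose m := Num.min e f; have m0 : 0 < m by rewrite lt_min e0.
have : S (t + m).
  split; first by rewrite addr_ge0 ?(ltW m0) // ub_le_sup //; case: supS.
  rewrite -!shiftD; split; [apply: (adapted_segment tp eA)|
    apply: (adapted_segment tq fA)]; by rewrite (ltW m0) ge_min lexx ?orbT.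
move=> /(ub_le_sup (proj2 supS)); rewrite -/t gerDl leNgt m0.
by [].
Qed.

(** If neither the ray along D nor the one along - D is ever left, D and - D are
    both adapted; then D j and D i agree in direction x i, so they are equal. *)
Lemma exists_collapse x v p q D : exposes x v -> adapted v p -> adapted v q ->
  cone_linear v D -> coarser p D -> coarser q D ->
  (exists i j, D i <> D j) ->
  exists s, [/\ adapted v (shift p D s), adapted v (shift q D s) &
    collapses p (shift p D s) \/ collapses q (shift q D s)].
Proof.
move=> xv pA qA DL pD qD [i [j Dij]]; apply: contrapT => nocollapse.
pose N : family := fun i => - D i.
have shiftN c s : shift c N s = shift c D (- s).
  by apply: funext => k; rewrite /shift scalerN scaleNr.
have dotN k y : dot (N k) y = - dot (D k) y.
  by rewrite /N -scaleN1r dotZl mulN1r.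
have DA : adapted v D.
  apply: (@adapted_ray _ p) => s s0; apply: contrapT => nA; apply: nocollapse.
  by apply: (@first_collapse x v p q D s) => // -[].
have NA : adapted v N.
  apply: (@adapted_ray _ p) => s s0; apply: contrapT => nA; apply: nocollapse.
  have [||||r] := @first_collapse x v p q N s xv pA qA _ _ _ s0.
  - by move=> k l y yk yl; rewrite !dotN (DL _ _ _ yk yl).
  - by move=> k l /pD kl; rewrite /N kl.
  - by move=> k l /qD kl; rewrite /N kl.
  - by case.
  by rewrite !shiftN => H; exists (- r).
apply: Dij; apply/esym; apply: (adapted_exposed xv DA); first exact: conv_gen.
by have := NA _ _ (exposes_in_cone i xv) j; rewrite !dotN lerN2.
Qed.

Lemma card_range_coarser c c' : coarser c c' -> range c' #<= range c.
Proof.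
move=> cc'.
have /choice[h hE] : forall e, exists e', forall i, c i = e -> c' i = e'.
  move=> e; have [[i <-]|ni] := pselect (exists i, c i = e).
    by exists (c' i) => j /cc'.
  by exists 0 => i ci; case: ni; exists i.
suff -> : range c' = h @` range c by exact: card_image_le.
apply/seteqP; split => [_ [i _ <-]|_ [_ [i _ <-] <-]].
  by exists (c i); [exists i|rewrite -(hE _ i)].
by exists i => //; rewrite -(hE _ i).
Qed.

(** Redirecting the value c i to c j shows that c' takes no more values than c
    does after c i is removed. *)
Lemma card_range_collapse c c' : coarser c c' -> collapses c c' ->
  ~~ (range c #<= range c').
Proof.
move=> cc' [i [j [cij c'ij]]]; apply/negP => le.
have [m mE] : exists m, range c `\ c i #= `I_m.
  by apply/finite_setP; apply: finite_setD; apply: finite_image; exact: finite_finset.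
have /card_eqPle[mS _] := mE.
have le' : range c' #<= range c `\ c i.
  pose f k := if pselect (c k = c i) then c j else c k.
  have -> : range c `\ c i = range f.
    apply/seteqP; split => [_ [[k _ <-] ki]|_ [k _ <-]].
      by exists k => //; rewrite /f; case: pselect.
    rewrite /f; case: (pselect (c k = c i)) => [ki|ki]; last by split => //; exists k.
    by split => [|/esym]; [exists j|exact: cij].
  apply: card_range_coarser => k l; rewrite /f.
  case: pselect => [ki|ki]; case: pselect => [li|li] kl.
  - by rewrite (cc' _ _ ki) (cc' _ _ li).
  - by rewrite (cc' _ _ ki) c'ij; exact: cc'.
  - by rewrite (cc' _ _ li) c'ij; exact: cc'.
  - exact: cc'.
have : `I_m.+1 #<= `I_m.
  have /card_eqPle[_ mS'] : range c #= `I_m.+1 by apply/eq_cardSP; exists (c i).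
  exact: card_le_trans mS' (card_le_trans le (card_le_trans le' mS)).
by rewrite card_le_II ltnn.
Qed.

End Collapse.

(** * The exposing functional *)

Section Gap.
Variables (R : realType) (d : nat).
Notation E := 'rV[R]_d.
Notation supp := Defs.support.
Notation pt := Defs.point.
Implicit Types (P Q : polytope R d) (V W : vpolytope R d) (x y : E).

Lemma support_pscale a P x : 0 <= a -> supp (pscale a P) x = a * supp P x.
Proof.
move=> a0; have [z Pz zmax] := Defs.support_max P x.
rewrite (Defs.supportE Pz zmax) -dotZl; apply: Defs.supportE; first by exists z.
by move=> _ [y Py <-]; rewrite !dotZl ler_wpM2l // zmax.
Qed.

Lemma support_point (t : E) x : supp (pt t) x = dot t x.
Proof. by apply: Defs.supportE => // y ->. Qed.

Lemma support0 x : supp (0 : polytope R d) x = 0.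
Proof. by rewrite -[RHS](dot0l x) -support_point. Qed.

Lemma cpwlD V W x : cpwl (V + W) x = cpwl V x + cpwl W x.
Proof.
elim/vpolytopeP: V => P Q; elim/vpolytopeP: W => P' Q'.
by rewrite vdiffD !cpwlE !Defs.supportD; ring.
Qed.

Lemma cpwlN V x : cpwl (- V) x = - cpwl V x.
Proof. by elim/vpolytopeP: V => P Q; rewrite vdiffN !cpwlE opprB. Qed.

Lemma cpwlZ a V x : cpwl (a *: V) x = a * cpwl V x.
Proof.
have pos b : 0 <= b -> cpwl (b *: V) x = b * cpwl V x.
  move=> b0; elim/vpolytopeP: V => P Q.
  by rewrite vdiffZ // !cpwlE !support_pscale // mulrBr.
case: (leP 0 a) => [/pos//|/ltW a0].
by apply: oppr_inj; rewrite -cpwlN -scaleNr pos ?oppr_ge0 // mulNr.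
Qed.

Lemma cpwl_trans (t : E) x : cpwl (trans t) x = dot t x.
Proof. by rewrite cpwlE support_point support0 subr0. Qed.

(** The failure of additivity of the support function at x and y; translations
    add linear functions and do not change it, so it lives on translation
    classes. *)
Definition gap x y (u : tvpolytope R d) : R :=
  cpwl (repr u) x + cpwl (repr u) y - cpwl (repr u) (x + y).

Lemma gap_tproj x y V : gap x y (tproj V) = cpwl V x + cpwl V y - cpwl V (x + y).
Proof.
have /tproj_eq[t /(canRL (subrK _)) e] := tproj_repr (tproj V).
by rewrite /gap e !cpwlD !cpwl_trans dotDr; ring.
Qed.

Lemma gap_scalar x y : scalar (gap x y).
Proof.
move=> a; elim/tvpolytopeP => V; elim/tvpolytopeP => W.
rewrite -tprojZ -tprojD !gap_tproj !cpwlD !cpwlZ.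
ring.
Qed.

Lemma gap_tclass x y P :
  gap x y (tclass P) = supp P x + supp P y - supp P (x + y).
Proof.
by rewrite gap_tproj !cpwlE !support0 !subr0.
Qed.

Lemma gap_ge0 x y P : 0 <= gap x y (tclass P).
Proof.
have [z Pz zmax] := Defs.support_max P (x + y).
have [p Pp pmax] := Defs.support_max P x.
have [q Pq qmax] := Defs.support_max P y.
rewrite gap_tclass (Defs.supportE Pz zmax) (Defs.supportE Pp pmax).
rewrite (Defs.supportE Pq qmax) dotDr.
by have := pmax z Pz; have := qmax z Pz; lra.
Qed.

(** The support function of a polytope is additive at two directions exactly
    when some point is maximal in both.  At e i and e j the only maximisers are
    c i and c j. *)
Lemma gap_hull_eq0 n (v e c : 'I_n.+1 -> E) i j : exposes e v -> adapted v c ->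
  (gap (e i) (e j) (tclass (hull c)) = 0) <-> (c i = c j).
Proof.
move=> ev cA.
have ei := cA _ _ (exposes_in_cone i ev); have ej := cA _ _ (exposes_in_cone j ev).
rewrite gap_tclass (support_hull ei) (support_hull ej); split => [|cij].
  have [z cz zmax] := Defs.support_max (hull c) (e i + e j).
  rewrite (Defs.supportE cz zmax) dotDr => g0.
  have zi := hull_dot_le ei cz; have zj := hull_dot_le ej cz.
  rewrite -(adapted_exposed ev cA cz (i := i)); last by lra.
  by rewrite -(adapted_exposed ev cA cz (i := j)) //; lra.
have ij : in_cone c i (e i + e j).
  by move=> k; rewrite !dotDr lerD ?ei // cij ej.
by rewrite (support_hull ij) dotDr cij subrr.
Qed.

Lemma tclassD P Q : tclass (P + Q) = tclass P + tclass Q.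
Proof. by rewrite /tclass -tprojD vdiffD addr0. Qed.

Lemma tclass_addr_eq P Q P' Q' : tclass P - tclass Q = tclass P' - tclass Q' <->
  tclass (P + Q') = tclass (P' + Q).
Proof.
rewrite !tclassD; split => [/eqP|e]; last first.
  by apply/eqP; rewrite subr_eq addrAC -e addrK.
by rewrite subr_eq addrAC eq_sym subr_eq => /eqP.
Qed.

Lemma deformation_cone_tclass K P Q : tclass P = tclass Q ->
  deformation_cone K P -> deformation_cone K Q.
Proof.
move=> /tclass_eq[t ->] [T [a [a0 KE]]].
by exists (T + pt t), a; split => //; rewrite KE -addrA (addrC T).
Qed.

Lemma hull_translate n (v c : 'I_n.+1 -> E) t : adapted v c ->
  hull c + pt t = hull (fun i => c i + t).
Proof.
move=> cA; have -> : pt t = hull (fun _ : 'I_n.+1 => t).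
  apply: polytope_eq; apply/seteqP; split => [_ ->|z [w [_ w1 ->]]] /=.
    exact: (conv_gen _ ord0).
  by rewrite -scaler_suml w1 scale1r.
by rewrite (@hullD _ _ _ v) // => i y _ j.
Qed.

Lemma rep_polyhedron_hull n (v p q : 'I_n.+1 -> E) V :
  adapted v p -> adapted v q ->
  tproj V = tclass (hull p) - tclass (hull q) ->
  rep_polyhedron (hull v) V (tclass (hull p), tclass (hull q)).
Proof.
by move=> pA qA VE; exists (hull p), (hull q);
  split => //; exact: adapted_deformation.
Qed.

(** A nonconstant D would lead, along p + s D and q + s D, to a representative
    in which two vertices have merged. *)
Lemma minimal_rigid n (e v p q D : 'I_n.+1 -> E) V : exposes e v ->
  adapted v p -> adapted v q ->
  minimal_representative (hull v) V (hull p) (hull q) ->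
  cone_linear v D -> coarser p D -> coarser q D -> forall i j, D i = D j.
Proof.
move=> ev pA qA [[P [Q [_ _ [eP eQ] VE]]] nmin] DL pD qD i j.
apply: contrapT => Dij; apply: nmin.
have [|s [sp sq col]] := exists_collapse ev pA qA DL pD qD; first by exists i, j.
exists (hull (shift p D s)), (hull (shift q D s)); split.
- apply: rep_polyhedron_hull => //; rewrite VE -eP -eQ; apply/tclass_addr_eq.
  rewrite (hullD pA sq) (hullD sp qA); congr (tclass (hull _)).
  by apply: funext => k; rewrite /shift addrA addrAC.
- rewrite !(vertices_hull ev) //; apply: card_range_coarser.
  exact: shift_coarser.
- rewrite !(vertices_hull ev) //; apply: card_range_coarser.
  exact: shift_coarser.
- rewrite !(vertices_hull ev) //.
  by case: col => col; [left|right]; apply: card_range_collapse col;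
    exact: shift_coarser.
Qed.

(** Minus this function exposes the minimal representative given by p and q. *)
Definition gap_sum n (e p q : 'I_n.+1 -> E) (z : tvpolytope R d * tvpolytope R d) : R :=
  \sum_i \sum_(j | p i == p j) gap (e i) (e j) z.1 +
  \sum_i \sum_(j | q i == q j) gap (e i) (e j) z.2.

Lemma gap_sum_scalar n (e p q : 'I_n.+1 -> E) : scalar (gap_sum e p q).
Proof.
move=> a z z'; rewrite /gap_sum mulrDr addrACA; congr (_ + _);
rewrite mulr_sumr -big_split; apply: eq_bigr => i _;
by rewrite mulr_sumr -big_split; apply: eq_bigr => j _; rewrite gap_scalar.
Qed.

Lemma gap_sum_ge0 n (e p q : 'I_n.+1 -> E) P Q :
  0 <= gap_sum e p q (tclass P, tclass Q).
Proof. by rewrite addr_ge0 //; do 2!(apply: sumr_ge0 => ? _); exact: gap_ge0. Qed.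

Lemma gap_sum_eq0 n (e v p q a b : 'I_n.+1 -> E) : exposes e v ->
  adapted v a -> adapted v b ->
  gap_sum e p q (tclass (hull a), tclass (hull b)) = 0 <->
  coarser p a /\ coarser q b.
Proof.
move=> ev aA bA.
have gap0 c r : adapted v c -> (\sum_i \sum_(j | r i == r j)
    gap (e i) (e j) (tclass (hull c)) == 0) <-> coarser r c.
  move=> cA; rewrite psumr_eq0 => [|i _]; last first.
    by apply: sumr_ge0 => j _; exact: gap_ge0.
  split => [/allP H i j rij|rc].
    have := H i; rewrite mem_index_enum psumr_eq0 => [|k _]; last exact: gap_ge0.
    move=> /(_ isT)/allP/(_ j); rewrite mem_index_enum rij eqxx => /(_ isT)/eqP.
    by move/(gap_hull_eq0 _ _ ev cA).
  apply/allP => i _; apply/implyP => _; rewrite big1 // => j /eqP/rc cij.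
  exact/(gap_hull_eq0 _ _ ev cA).
split => [/eqP|[/(gap0 _ _ aA)/eqP pa /(gap0 _ _ bA)/eqP qb]]; last first.
  by rewrite /gap_sum pa qb addr0.
rewrite paddr_eq0; try by do 2!(apply: sumr_ge0 => ? _); exact: gap_ge0.
by move=> /andP[/(gap0 _ _ aA) pa /(gap0 _ _ bA) qb].
Qed.

(** The displacements a - p and b - q differ by the translation t that realises
    the equality of the two differences, so they fall under [minimal_rigid]. *)
Lemma minimal_unique n (e v p q a b : 'I_n.+1 -> E) V : exposes e v ->
  adapted v p -> adapted v q -> adapted v a -> adapted v b ->
  minimal_representative (hull v) V (hull p) (hull q) ->
  tproj V = tclass (hull a) - tclass (hull b) ->
  coarser p a -> coarser q b ->
  tclass (hull a) = tclass (hull p) /\ tclass (hull b) = tclass (hull q).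
Proof.
move=> ev pA qA aA bA minPQ VE pa qb.
have [[P [Q [_ _ [eP eQ] VE']]] _] := minPQ.
move: VE'; rewrite VE -eP -eQ => /tclass_addr_eq/tclass_eq[t].
rewrite (hullD aA qA) (hullD pA bA) (hull_translate _ (adaptedD pA bA)).
have pbt : adapted v (fun i => p i + b i + t).
  by move=> i y yi j; rewrite !dotDl lerD2r lerD ?pA ?bA.
move/(hull_inj ev (adaptedD aA qA) pbt)/funeqP => aqE.
pose D i := a i - p i.
have DE i : b i + t - q i = D i.
  by apply/eqP; rewrite subr_eq /D addrAC eq_sym subr_eq aqE -addrA addrC.
have DL : cone_linear v D.
  by move=> i j y yi yj; rewrite !dotBl (adapted_cone_linear aA yi yj)
    (adapted_cone_linear pA yi yj).
have pD : coarser p D by move=> i j pij; rewrite /D pij (pa _ _ pij).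
have qD : coarser q D by move=> i j qij; rewrite -!DE qij (qb _ _ qij).
have Dc i := minimal_rigid ev pA qA minPQ DL pD qD i ord0.
split; apply/tclass_eq.
  exists (D ord0); rewrite (hull_translate _ pA); congr hull.
  by apply: funext => i; rewrite -(Dc i) /D addrC subrK.
exists (D ord0 - t); rewrite (hull_translate _ qA); congr hull.
by apply: funext => i; rewrite -(Dc i) -DE addrA [q i + _]addrC subrK addrK.
Qed.

End Gap.

Theorem corollary5p4 (R : realType) (d : nat) (K : polytope R d)
    (V : vpolytope R d) (hV : compatible (cpwl V) (normal_fan K))
    (P Q : polytope R d) (hPQ : minimal_representative K V P Q) :
  vertex (rep_polyhedron K V) (tclass P, tclass Q).
Proof.
have [n [v [e [KE ev]]]] := exposed_generators (psetP K).
have {}KE : K = hull v by apply: polytope_eq.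
rewrite {}KE {K hV} in hPQ *.
have [[P0 [Q0 [dP dQ [eP eQ] VE]]] _] := hPQ.
have [p pA PE] := deformation_adapted (deformation_cone_tclass (esym eP) dP).
have [q qA QE] := deformation_adapted (deformation_cone_tclass (esym eQ) dQ).
rewrite -{}eP -{}eQ {P0 Q0 dP dQ} in VE *; rewrite {}PE {}QE {P Q} in hPQ VE *.
pose f (z : tvpolytope R d * tvpolytope R d) := (- gap_sum e p q z)%R.
have f_scalar : scalar f.
  by move=> a z z'; rewrite /f gap_sum_scalar opprD mulrN.
pose l : {scalar (tvpolytope R d * tvpolytope R d)%type} :=
  HB.pack f (GRing.isLinear.Build R _ R *%R f f_scalar).
have lpq : l (tclass (hull p), tclass (hull q)) = 0%R.
  apply/eqP; rewrite oppr_eq0; apply/eqP/(gap_sum_eq0 _ _ ev pA qA).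
  by split.
exists l; apply/seteqP; split => [_ ->|_ [[A [B [dA dB -> VE']]] zmax]].
  split=> [|_ [A [B [_ _ -> _]]]]; first exact: rep_polyhedron_hull.
  by rewrite lpq oppr_le0; exact: gap_sum_ge0.
have [a aA AE] := deformation_adapted dA.
have [b bA BE] := deformation_adapted dB.
rewrite {}AE {}BE {A B dA dB} in VE' zmax *.
have := zmax _ (rep_polyhedron_hull pA qA VE); rewrite lpq oppr_ge0 => g0.
have /(gap_sum_eq0 _ _ ev aA bA)[pa qb] :
    gap_sum e p q (tclass (hull a), tclass (hull b)) = 0%R.
  by apply/eqP; rewrite eq_le g0 gap_sum_ge0.
by have [-> ->] := minimal_unique ev pA qA aA bA hPQ VE' pa qb.
Qed.
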